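(* Let $\mathbb X_i=\langle X_i,\rho_i\rangle$, $i\in I$, be $L_b$-structures with pairwise disjoint domains such that each $\mathbb X_i$ is connected and reversible, and let $\mathbb X=\bigcup_{i\in I}\mathbb X_i$. Then $\mathbb X$ is reversible if and only if $\langle \mathbb X_i: i\in I\rangle$ is a reversible sequence of structures and every $\mathbb Z$-sequence in $I$ is trivial.
   Context: An $L_b$-structure is a pair $\langle X,\rho\rangle$ with $\rho\subseteq X^2$. A homomorphism $f:\langle X,\rho\rangle\to\langle Y,\sigma\rangle$ is a map with $\langle x,y\rangle\in\rho\Rightarrow\langle f(x),f(y)\rangle\in\sigma$; a condensation is a bijective homomorphism; an isomorphism is a bijection $f$ with $\langle x,y\rangle\in\rho\Leftrightarrow\langle f(x),f(y)\rangle\in\sigma$. A structure is reversible iff every condensation from it to itself is an automorphism. The components of $\langle X,\rho\rangle$ are the classes of the smallest equivalence relation on $X$ containing $\rho$; the structure is connected iff it has exactly one component. For structures $\langle X_i,\rho_i\rangle$ with pairwise disjoint domains, $\bigcup_{i\in J}\mathbb X_i=\langle\bigcup_{i\in J}X_i,\bigcup_{i\in J}\rho_i\rangle$. Write $\mathbb Y\preccurlyeq_c\mathbb Z$ iff there is a condensation $\mathbb Y\to\mathbb Z$. $\mathrm{Sur}(I)$ (resp. $\mathrm{Sym}(I)$) is the set of surjections (resp. bijections) $I\to I$. The sequence $\langle\mathbb X_i:i\in I\rangle$ is a reversible sequence of structures iff there is no $f\in\mathrm{Sur}(I)\setminus\mathrm{Sym}(I)$ such that $\bigcup_{i\in f^{-1}[\{j\}]}\mathbb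 X_i\preccurlyeq_c\mathbb X_j$ for all $j\in I$. A $\mathbb Z$-sequence in $I$ is an injection $k\mapsto i_k$ from $\mathbb Z$ to $I$ such that $\mathbb X_{i_k}\preccurlyeq_c\mathbb X_{i_l}$ whenever $k<l$; it is trivial iff $\mathbb X_{i_k}\cong\mathbb X_{i_l}$ for all $k,l\in\mathbb Z$. *)

(* Defs.v *)
From mathcomp Require Import all_boot all_order all_algebra.
From mathcomp Require Import boolp classical_sets functions.

Set Implicit Arguments.
Unset Strict Implicit.
Unset Printing Implicit Defensive.

Local Open Scope classical_set_scope.

(* All domains are subsets of one ambient type T, so that disjointness and
   unions are the set-theoretic ones.  A map sdom A -> sdom B is represented by a
   function T -> T, of which only the restriction to sdom A matters; no map is
   lost, since when sdom B is empty so is sdom A and the identity represents the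
   empty map. *)
Record structure (T : Type) := Structure {
  sdom : set T;
  srel : set (T * T);
  srel_sub : srel `<=` sdom `*` sdom
}.

Definition homomorphism (T : Type) (A B : structure T) (f : T -> T) : Prop :=
  set_fun (sdom A) (sdom B) f /\
  forall x y, sdom A x -> sdom A y -> srel A (x, y) -> srel B (f x, f y).

Definition condensation (T : Type) (A B : structure T) (f : T -> T) : Prop :=
  homomorphism A B f /\ set_bij (sdom A) (sdom B) f.

Definition isomorphism (T : Type) (A B : structure T) (f : T -> T) : Prop :=
  set_bij (sdom A) (sdom B) f /\
  forall x y, sdom A x -> sdom A y -> (srel A (x, y) <-> srel B (f x, f y)).

Definition cond_le (T : Type) (A B : structure T) : Prop :=
  exists f : T -> T, condensation A B f.

Definition isomorphic (T : Type) (A B : structure T) : Prop :=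
  exists f : T -> T, isomorphism A B f.

Definition reversible (T : Type) (A : structure T) : Prop :=
  forall f : T -> T, condensation A A f -> isomorphism A A f.

Definition equivalence_on (T : Type) (D : set T) (E : set (T * T)) : Prop :=
  [/\ E `<=` D `*` D,
      forall x, D x -> E (x, x),
      forall x y, E (x, y) -> E (y, x) &
      forall x y z, E (x, y) -> E (y, z) -> E (x, z)].

Definition generated_equiv (T : Type) (A : structure T) : set (T * T) :=
  \bigcap_(E in [set E | equivalence_on (sdom A) E /\ srel A `<=` E]) E.

Definition components (T : Type) (A : structure T) : set (set T) :=
  [set [set y | generated_equiv A (x, y)] | x in sdom A].

Definition connected (T : Type) (A : structure T) : Prop :=
  exists C : set T, components A = [set C].

Lemma union_srel_sub (T I : Type) (X : I -> structure T) (J : set I) :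
  \bigcup_(i in J) srel (X i) `<=`
  (\bigcup_(i in J) sdom (X i)) `*` (\bigcup_(i in J) sdom (X i)).
Proof. by move=> p [i Ji /srel_sub [p1 p2]]; split; exists i. Qed.

Definition union (T I : Type) (X : I -> structure T) (J : set I) :
  structure T := Structure (@union_srel_sub T I X J).

Definition Sur (I : Type) : set (I -> I) := [set f | set_surj setT setT f].

Definition Sym (I : Type) : set (I -> I) := [set f | set_bij setT setT f].

Definition reversible_sequence (T I : Type) (X : I -> structure T) : Prop :=
  ~ exists2 f : I -> I, (@Sur I `\` @Sym I) f &
      forall j : I, cond_le (union X (f @^-1` [set j])) (X j).

Definition Z_sequence (T I : Type) (X : I -> structure T) (s : int -> I) :
  Prop :=
  injective s /\ forall k l : int, (k < l)%R -> cond_le (X (s k)) (X (s l)).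

Definition trivial_Z_sequence (T I : Type) (X : I -> structure T)
  (s : int -> I) : Prop :=
  forall k l : int, isomorphic (X (s k)) (X (s l)).

(* Main.v *)
Require Import Defs.
From mathcomp Require Import all_boot all_order all_algebra.
From mathcomp Require Import boolp classical_sets functions.

Local Open Scope classical_set_scope.

(** A condensation [F] of the union maps each connected [X i] into a single
    [X (f i)], with [f] onto, and conversely such an [f] together with
    condensations onto the [X j] glues to a condensation of the union.  If the
    sequence is reversible, [f] is a bijection; then along a finite [f]-orbit
    [X (f i)] condenses back onto [X i], and along an infinite one the
    Z-sequence [k |-> f^k i] gives [X (f i)] isomorphic to [X i], so in both
    cases reversibility of [X i] makes [F] an isomorphism from [X i] to
    [X (f i)].  Conversely, if the union is reversible, every glued
    condensation is an isomorphism: a non-injective [f] would make a connected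
    [X j] isomorphic to a disconnected union, and shifting along a Z-sequence
    makes its consecutive terms isomorphic. *)

Set Implicit Arguments.
Unset Strict Implicit.
Unset Printing Implicit Defensive.

Import Order.TTheory GRing.Theory Num.Theory.

(** * Condensations and isomorphisms of structures *)

Lemma structure_eq (T : Type) (A B : structure T) :
  sdom A = sdom B -> srel A = srel B -> A = B.
Proof.
case: A B => [D R s] [D' R' s'] /= eD eR; subst D' R'.
by rewrite (Prop_irrelevance s s').
Qed.

Lemma set_bijP (T U : Type) (A : set T) (B : set U) (f : T -> U) :
  set_bij A B f <->
  [/\ forall x, A x -> B (f x),
      forall x y, A x -> A y -> f x = f y -> x = y &
      forall y, B y -> exists2 x, A x & f x = y].
Proof.
split=> [[fAB inj_f surj_f]|[fAB inj_f surj_f]]; split=> //.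
  by move=> x y Ax Ay; apply: inj_f; rewrite inE.
by move=> x y; rewrite !inE; apply: inj_f.
Qed.

Lemma srel_dom (T : Type) (A : structure T) (x y : T) :
  srel A (x, y) -> sdom A x /\ sdom A y.
Proof. by move/srel_sub. Qed.

Lemma condensationP (T : Type) (A B : structure T) (f : T -> T) :
  condensation A B f <->
  set_bij (sdom A) (sdom B) f /\
  forall x y, srel A (x, y) -> srel B (f x, f y).
Proof.
split=> [[[_ homf] bijf]|[bijf homf]].
  by split=> // x y Axy; have [Ax Ay] := srel_dom Axy; apply: homf.
by split=> //; split=> [|x y _ _]; [case: bijf | apply: homf].
Qed.

Lemma isomorphism_condensation (T : Type) (A B : structure T) (f : T -> T) :
  isomorphism A B f -> condensation A B f.
Proof.
move=> [bijf relf]; apply/condensationP; split=> // x y Axy.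
by have [Ax Ay] := srel_dom Axy; apply/relf.
Qed.

Lemma set_bij_comp (T U V : Type) (A : set T) (B : set U) (C : set V)
    (f : T -> U) (g : U -> V) :
  set_bij A B f -> set_bij B C g -> set_bij A C (g \o f).
Proof.
move=> /set_bijP[fAB injf surf] /set_bijP[gBC injg surg]; apply/set_bijP.
split=> [x Ax|x y Ax Ay /= /injg|z /surg[y /surf[x Ax <-] <-]].
- by apply/gBC/fAB.
- by move=> /(_ (fAB _ Ax) (fAB _ Ay)); apply: injf.
- by exists x.
Qed.

Lemma condensation_comp (T : Type) (A B C : structure T) (f g : T -> T) :
  condensation A B f -> condensation B C g -> condensation A C (g \o f).
Proof.
move=> /condensationP[bf hf] /condensationP[bg hg]; apply/condensationP.
by split=> [|x y /hf/hg //]; apply: set_bij_comp bg.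
Qed.

Lemma cond_le_refl (T : Type) (A : structure T) : cond_le A A.
Proof.
exists id; apply/condensationP; split=> //; apply/set_bijP.
by split=> // y Ay; exists y.
Qed.

Lemma cond_le_trans (T : Type) (B A C : structure T) :
  cond_le A B -> cond_le B C -> cond_le A C.
Proof. by move=> [f cf] [g cg]; exists (g \o f); apply: condensation_comp cg. Qed.

Lemma isomorphic_cond_le (T : Type) (A B : structure T) :
  isomorphic A B -> cond_le A B.
Proof. by move=> [f /isomorphism_condensation cf]; exists f. Qed.

Lemma isomorphic_refl (T : Type) (A : structure T) : isomorphic A A.
Proof.
exists id; split=> //; apply/set_bijP.
by split=> // y Ay; exists y.
Qed.

Lemma isomorphic_trans (T : Type) (B A C : structure T) :
  isomorphic A B -> isomorphic B C -> isomorphic A C.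
Proof.
move=> [f [bf hf]] [g [bg hg]]; exists (g \o f); split.
  exact: set_bij_comp bg.
have /set_bijP[fAB _ _] := bf.
by move=> x y Ax Ay; rewrite hf// hg//; apply: fAB.
Qed.

Lemma isomorphic_sym (T : Type) (A B : structure T) :
  isomorphic A B -> isomorphic B A.
Proof.
move=> [f [/set_bijP[fAB injf surf] hf]].
(* The inverse has to be total on [T]; outside [sdom B] any value will do. *)
have /choice[g gP] : forall y, exists x, sdom B y -> sdom A x /\ f x = y.
  move=> y; have [By|nBy] := pselect (sdom B y); last by exists y.
  by have [x Ax fx] := surf y By; exists x.
exists g; split.
  apply/set_bijP; split=> [y /gP[]//|y z /gP[_ fy] /gP[_ fz] gyz|x Ax].
    by rewrite -fy gyz.
  by exists (f x); [apply: fAB|have [Agf /injf->] := gP _ (fAB _ Ax)].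
move=> y z /gP[Ay fy] /gP[Az fz].
by rewrite hf// fy fz.
Qed.

(** Composing [f] with a condensation [g] back to [A] gives an automorphism of [A]. A related pair
    [f x], [f y] is sent by [g] to a related pair, and the automorphism reflects it to [x], [y]. *)
Lemma reversible_condensation_iso (T : Type) (A B : structure T) (f : T -> T) :
  reversible A -> cond_le B A -> condensation A B f -> isomorphism A B f.
Proof.
move=> revA [g cg] cf; have [_ relgf] := revA _ (condensation_comp cf cg).
have /condensationP[bijf homf] := cf; have /condensationP[_ homg] := cg.
split=> // x y Ax Ay; split; first exact: homf.
by move=> /homg gfxy; apply/relgf.
Qed.

(** * Connectedness and disjoint unions *)

Lemma connected_nonempty (T : Type) (A : structure T) :
  connected A -> exists x, sdom A x.
Proof.
move=> [C eC]; have [x Ax _] : components A C by rewrite eC.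
by exists x.
Qed.

(** The pairs of points on which [P] agrees form an equivalence relation containing [srel A], hence
    containing the generated one, which relates any two points. *)
Lemma connected_ind (T : Type) (A : structure T) (P : T -> Prop) :
  connected A -> (forall x y, srel A (x, y) -> (P x <-> P y)) ->
  forall x y, sdom A x -> sdom A y -> P x -> P y.
Proof.
move=> [C eC] relP x y Ax Ay Px.
have classC z : sdom A z -> [set t | generated_equiv A (z, t)] = C.
  move=> Az; suff : components A [set t | generated_equiv A (z, t)] by rewrite eC.
  by exists z.
have : [set t | generated_equiv A (x, t)] y.
  by rewrite classC// -(classC y Ay) => E [[_ reflE _ _] _]; apply: reflE.
move=> /(_ [set p | [/\ sdom A p.1, sdom A p.2 & (P p.1 <-> P p.2)]]) /=.
case=> [|_ _ [Pxy _]]; last exact: Pxy.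
split; last first.
  by move=> [u v] Auv /=; have [] := srel_dom Auv; split=> //; apply: relP.
split=> [[u v] [] //|//|u v [Au Av uv]|u v w [Au Av uv] [_ Aw vw]]; split=> //=.
- by rewrite uv.
- by rewrite uv.
Qed.

Lemma disjoint_domains_inj (T I : Type) (X : I -> structure T) :
  (forall i j, i <> j -> sdom (X i) `&` sdom (X j) = set0) ->
  forall i j x, sdom (X i) x -> sdom (X j) x -> i = j.
Proof.
move=> disjX i j x Xix Xjx; apply: contrapT => /disjX eq0.
by have : (sdom (X i) `&` sdom (X j)) x by []; rewrite eq0.
Qed.

Lemma union_set1 (T I : Type) (X : I -> structure T) (i : I) :
  union X [set i] = X i.
Proof. by apply: structure_eq; rewrite /= bigcup_set1. Qed.

Lemma preimage_set1_inj (I J : Type) (f : I -> J) (i : I) :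
  injective f -> f @^-1` [set f i] = [set i].
Proof. by move=> injf; apply/seteqP; split=> [j /injf|j ->]. Qed.

(** * Condensations of the union and maps of indices *)

Lemma condensation_index_map (T I : Type) (X : I -> structure T) (F : T -> T) :
  (forall i j, i <> j -> sdom (X i) `&` sdom (X j) = set0) ->
  (forall i, connected (X i)) ->
  condensation (union X setT) (union X setT) F ->
  exists2 f : I -> I, @Sur I f &
    forall j, condensation (union X (f @^-1` [set j])) (X j) F.
Proof.
move=> /disjoint_domains_inj disjX connX.
move=> /condensationP[/set_bijP[FX injF surF] homF].
have /choice[f fP] :
    forall i, exists j, forall x, sdom (X i) x -> sdom (X j) (F x).
  move=> i; have [x0 Xx0] := connected_nonempty (connX i).
  have [|j _ Xj0] := FX x0; first by exists i.
  (* [F] sends related points to related points, which lie in a common component, so [P] spreads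
     from [x0] through [X i]. *)
  exists j => x Xx; pose P z := sdom (X j) (F z).
  apply: (@connected_ind _ _ P (connX i) _ x0) => // u v Xuv.
  have [k _ Xk] : srel (union X setT) (F u, F v).
    by apply: homF; exists i.
  have [ku kv] := srel_dom Xk.
  by rewrite /P; split=> [/(disjX _ _ _ ku) <-|/(disjX _ _ _ kv) <-].
have fE i j x : sdom (X i) x -> sdom (X j) (F x) -> f i = j.
  by move=> /fP Xfi; apply: disjX Xfi.
exists f.
  move=> j _; have [y Xjy] := connected_nonempty (connX j).
  have [|x [i _ Xix] Fxy] := surF y; first by exists j.
  by exists i => //; apply: fE Xix _; rewrite Fxy.
move=> j; apply/condensationP; split; last first.
  move=> x y [i /= <- Xixy]; have [Xix Xiy] := srel_dom Xixy.
  have [k _ Xk] : srel (union X setT) (F x, F y) by apply: homF; exists i.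
  by have [Xkx _] := srel_dom Xk; rewrite (fE _ _ _ Xix Xkx).
apply/set_bijP; split.
- by move=> x [i /= <- Xix]; apply: fP.
- by move=> x y [i _ Xix] [k _ Xky]; apply: injF; [exists i|exists k].
- move=> y Xjy; have [|x [i _ Xix] Fxy] := surF y; first by exists j.
  by exists x => //; exists i => //=; apply: fE Xix _; rewrite Fxy.
Qed.

Lemma glue_condensations (T I : Type) (X : I -> structure T) (f : I -> I) :
  (forall i j, i <> j -> sdom (X i) `&` sdom (X j) = set0) ->
  (forall j, cond_le (union X (f @^-1` [set j])) (X j)) ->
  exists2 F : T -> T, condensation (union X setT) (union X setT) F &
    forall i x, sdom (X i) x -> sdom (X (f i)) (F x).
Proof.
move=> /disjoint_domains_inj disjX /choice[g gP].
(* Disjointness makes the index of [x] unique; outside all domains the value is arbitrary. *)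
have /choice[F FP] : forall x, exists y, forall i, sdom (X i) x -> y = g (f i) x.
  move=> x; have [[i Xix]|nX] := pselect (exists i, sdom (X i) x).
    by exists (g (f i) x) => j /(disjX _ _ _ Xix) <-.
  by exists x => i Xix; case: nX; exists i.
have FX i x : sdom (X i) x -> sdom (X (f i)) (F x).
  move=> Xix; rewrite (FP _ _ Xix).
  by have /condensationP[/set_bijP[gX _ _] _] := gP (f i); apply: gX; exists i.
exists F => //; apply/condensationP; split; last first.
  move=> x y [i _ Xixy]; have [Xix Xiy] := srel_dom Xixy.
  exists (f i) => //; rewrite (FP _ _ Xix) (FP _ _ Xiy).
  by have /condensationP[_ homg] := gP (f i); apply: homg; exists i.
apply/set_bijP; split.
- by move=> x [i _ /FX Xx]; exists (f i).
(* Equal images force [f i = f j], so both points lie in the one fibre union on which [g (f i)] is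
   injective. *)
- move=> x y [i _ Xix] [j _ Xjy] Fxy.
  have fij : f i = f j by apply: disjX (FX _ _ Xix) _; rewrite Fxy; apply: FX.
  have /condensationP[/set_bijP[_ injg _] _] := gP (f i).
  apply: injg; [by exists i|by exists j|].
  by move: Fxy; rewrite (FP _ _ Xix) (FP _ _ Xjy) fij.
- move=> y [j _ Xjy]; have /condensationP[/set_bijP[_ _ surg] _] := gP j.
  have [x [i /= fi Xix] gx] := surg y Xjy.
  by exists x; [exists i|rewrite (FP _ _ Xix) fi].
Qed.

(** * Orbits indexed by the integers *)

Lemma int_shift_ind (P : int -> Prop) :
  (forall k : int, P k <-> P (k + 1)%R) -> forall k l, P k -> P l.
Proof.
move=> stepP; have shift (n : nat) k : P k <-> P (k + n%:Z)%R.
  elim: n => [|n IHn]; first by rewrite addr0.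
  by rewrite IHn stepP -addrA -addn1 PoszD.
move=> k l Pk; have [kl|/ltW lk] := leP k l.
  have -> : l = (k + `|l - k|%N%:Z)%R by rewrite gez0_abs ?subr_ge0// subrKC.
  exact: (shift _ _).1.
apply: (shift `|k - l|%N l).2.
by rewrite gez0_abs ?subr_ge0// subrKC.
Qed.

Lemma bijection_orbit (I : Type) (f : I -> I) (i : I) :
  @Sym I f -> exists2 s : int -> I, s 0%R = i & forall k, s (k + 1)%R = f (s k).
Proof.
move=> /set_bijP[_ _ surf].
have /choice[g gP] : forall y, exists x, f x = y.
  by move=> y; have [x _] := surf y Logic.I; exists x.
(* [Negz n] is the integer [- n.+1], hence [n.+1] applications of the right inverse [g]. *)
exists (fun k => match k with Posz n => iter n f i | Negz n => iter n.+1 g i end).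
  by [].
case=> [n|[|n]] /=; first by rewrite addn1.
  by rewrite gP.
by rewrite gP subn1.
Qed.

Lemma int_orbit_iter (I : Type) (f : I -> I) (s : int -> I) :
  (forall k, s (k + 1)%R = f (s k)) ->
  forall (n : nat) k, s (k + n%:Z)%R = iter n f (s k).
Proof.
move=> sS; elim=> [|n IHn] k; first by rewrite addr0.
by rewrite -addn1 PoszD addrA sS IHn addn1.
Qed.

Lemma lt_int_addS (k l : int) : (k < l)%R -> exists n : nat, l = (k + n.+1%:Z)%R.
Proof.
move=> kl; exists `|l - k|%N.-1; rewrite prednK ?absz_gt0 ?subr_eq0 ?gt_eqF//.
by rewrite gtz0_abs ?subr_gt0// subrKC.
Qed.

Lemma cond_le_iter (T I : Type) (X : I -> structure T) (f : I -> I) :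
  (forall i, cond_le (X i) (X (f i))) ->
  forall n i, cond_le (X i) (X (iter n f i)).
Proof.
move=> leX; elim=> [|n IHn] i; first exact: cond_le_refl.
exact: cond_le_trans (IHn i) (leX _).
Qed.

Lemma cond_le_image (T I : Type) (X : I -> structure T) (f : I -> I) (i : I) :
  @Sym I f -> (forall i, cond_le (X i) (X (f i))) ->
  (forall s, Z_sequence X s -> trivial_Z_sequence X s) ->
  cond_le (X (f i)) (X i).
Proof.
move=> symf leX trivX; have [s s0 sS] := bijection_orbit i symf.
have /set_bijP[_ injf _] := symf.
have [[n fni]|aper] := pselect (exists n, iter n.+1 f i = i).
  (* In a finite orbit, [n] further steps from [f i] lead back to [i]. *)
  by have := cond_le_iter leX n (f i); rewrite -iterSr fni.
have neq_s k l : (k < l)%R -> s k <> s l.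
  move=> /lt_int_addS[n ->] skl; apply: aper; exists n.
  rewrite -s0 -(int_orbit_iter sS).
  (* A repetition at [k] moves to index 0, backwards by injectivity of [f], and would make the orbit
     of [i] finite. *)
  apply: (@int_shift_ind (fun k => s (k + n.+1%:Z)%R = s k) _ k 0%R) => //.
  move=> h; rewrite addrAC !sS; split=> [->//|]; exact: injf.
rewrite -s0 -sS; apply/isomorphic_cond_le/trivX; split.
  by move=> k l skl; have [/neq_s//|/neq_s nlk|//] := ltgtP k l; case: nlk.
by move=> k l /lt_int_addS[n ->]; rewrite (int_orbit_iter sS); apply: cond_le_iter.
Qed.

(** * Sufficiency of the two conditions *)

Lemma union_reversible (T I : Type) (X : I -> structure T) :
  (forall i j, i <> j -> sdom (X i) `&` sdom (X j) = set0) ->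
  (forall i, connected (X i)) -> (forall i, reversible (X i)) ->
  reversible_sequence X ->
  (forall s, Z_sequence X s -> trivial_Z_sequence X s) ->
  reversible (union X setT).
Proof.
move=> disjX connX revX revseq trivX F cF.
have [f surf fP] := condensation_index_map disjX connX cF.
have symf : @Sym I f.
  by apply: contrapT => nsym; apply: revseq; exists f => // j; exists F.
have /set_bijP[_ injf' _] := symf.
have injf : injective f by move=> i j; apply: injf'.
have cFX i : condensation (X i) (X (f i)) F.
  by have := fP (f i); rewrite preimage_set1_inj// union_set1.
have isoF i : isomorphism (X i) (X (f i)) F.
  apply: reversible_condensation_iso => //.
  by apply: (@cond_le_image _ _ X f i) => // j; exists F.
have /condensationP[bijF homF] := cF.
split=> // x y [i _ Xix] [j _ Xjy]; split; first exact: homF.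
move=> [k _ Xk]; have [Xkx Xky] := srel_dom Xk.
have [/set_bijP[FX _ _] relF] := isoF i.
have [/set_bijP[FX' _ _] _] := isoF j.
have disj := disjoint_domains_inj disjX.
(* Related images lie in one component [X k], so [f i = k = f j] and both points come from the same
   [X i]. *)
have fik : f i = k := disj _ _ _ (FX _ Xix) Xkx.
have ij : i = j by apply: injf; rewrite fik; apply: disj Xky (FX' _ Xjy).
by subst j; exists i => //; apply/relF; rewrite // fik.
Qed.

(** * Necessity of the two conditions *)

Lemma reversible_union_sequence (T I : Type) (X : I -> structure T) :
  (forall i j, i <> j -> sdom (X i) `&` sdom (X j) = set0) ->
  (forall i, connected (X i)) ->
  reversible (union X setT) -> reversible_sequence X.
Proof.
move=> disjX connX revU [f [surf nsymf] leX]; apply: nsymf.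
have [F /revU[/set_bijP[_ injF surF] relF] FX] := glue_condensations disjX leX.
have disj := disjoint_domains_inj disjX.
apply/set_bijP; split=> // i i' _ _ fii'.
have [x Xix] := connected_nonempty (connX i).
have [x' Xix'] := connected_nonempty (connX i').
(* [P] says that the preimage of [y] under [F] lies in [X i]. It holds at [F x]; carried through the
   connected [X (f i)] to [F x'], it puts [x'] in [X i], so [i = i']. *)
pose P y := forall z, sdom (union X setT) z -> F z = y -> sdom (X i) z.
suff PFx' : P (F x') by apply: (disj _ _ x'); [apply: PFx'; first exists i'|].
have step u v : srel (X (f i)) (u, v) \/ srel (X (f i)) (v, u) -> P u -> P v.
  move=> Xuv Pu b Ub Fb; have [|a Ua Fa] := surF u.
    by exists (f i) => //; case: Xuv => Xuv; have [] := srel_dom Xuv.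
  have Xia := Pu a Ua Fa.
  (* As an automorphism, [F] reflects the relation, so preimages of related points share a
     component. *)
  have [l [Xla Xlb]] : exists l, sdom (X l) a /\ sdom (X l) b.
    have : srel (union X setT) (a, b) \/ srel (union X setT) (b, a).
      by case: Xuv => Xuv; [left|right]; apply/relF; rewrite // Fa Fb; exists (f i).
    by case=> -[l _ Xl]; have [] := srel_dom Xl; exists l.
  by rewrite (disj _ _ _ Xia Xla).
apply: (@connected_ind _ _ P (connX (f i)) _ (F x)).
- by move=> u v Xuv; split; apply: step; [left|right].
- exact: FX.
- by rewrite fii'; apply: FX.
- by move=> z Uz /injF -> //; exists i.
Qed.

(** The fibres of [f] are singletons, so the condensations glue to an automorphism of the union,
    whose restriction to [X i] is the isomorphism sought. *)
Lemma reversible_union_glue_iso (T I : Type) (X : I -> structure T) (f : I -> I) :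
  (forall i j, i <> j -> sdom (X i) `&` sdom (X j) = set0) ->
  reversible (union X setT) -> @Sym I f ->
  (forall i, cond_le (X i) (X (f i))) -> forall i, isomorphic (X i) (X (f i)).
Proof.
move=> disjX revU /set_bijP[_ injf' surf] leX i.
have injf : injective f by move=> j k; apply: injf'.
have leU j : cond_le (union X (f @^-1` [set j])) (X j).
  have [k _ <-] := surf j Logic.I.
  by rewrite preimage_set1_inj// union_set1.
have [F /revU[/set_bijP[_ injF surF] relF] FX] := glue_condensations disjX leU.
have disj := disjoint_domains_inj disjX.
have srelU k x y : sdom (X k) x -> srel (union X setT) (x, y) <-> srel (X k) (x, y).
  move=> Xkx; split=> [[l _ Xlxy]|]; last by exists k.
  by have [Xlx _] := srel_dom Xlxy; rewrite (disj _ _ _ Xkx Xlx).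
exists F; split.
  apply/set_bijP; split=> [x /FX //|x y Xix Xiy|y Xy].
    by apply: injF; exists i.
  have [|x [j _ Xjx] Fx] := surF y; first by exists (f i).
  exists x => //; suff -> : i = j by [].
  by apply/injf/(disj _ _ _ Xy); rewrite -Fx; apply: FX.
move=> x y Xix Xiy; rewrite -srelU// -srelU; last exact: FX.
by apply: relF; exists i.
Qed.

Lemma shift_bijection (I : Type) (s : int -> I) : injective s ->
  exists2 f : I -> I, @Sym I f &
    (forall k, f (s k) = s (k + 1)%R) /\
    (forall i, (forall k, s k <> i) -> f i = i).
Proof.
move=> injs.
have /choice[f fP] : forall i, exists j,
    (forall k, s k = i -> j = s (k + 1)%R) /\ ((forall k, s k <> i) -> j = i).
  move=> i; have [[k sk]|nsk] := pselect (exists k, s k = i).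
    exists (s (k + 1)%R); split=> [l|/(_ k)//].
    by rewrite -sk => /injs ->.
  by exists i; split=> // k sk; case: nsk; exists k.
have fs k : f (s k) = s (k + 1)%R by apply: (fP (s k)).1.
have fN i : (forall k, s k <> i) -> f i = i by apply: (fP i).2.
have rangeP i : (exists k, i = s k) \/ (forall k, s k <> i).
  have [[k <-]|nsk] := pselect (exists k, s k = i); first by left; exists k.
  by right=> k sk; apply: nsk; exists k.
exists f => //; apply/set_bijP; split=> // [i j _ _|j _].
  have [[k ->]|ni] := rangeP i; have [[l ->]|nj] := rangeP j.
  - by rewrite !fs => /injs/addIr ->.
  - by rewrite fs (fN _ nj) => /nj.
  - by rewrite fs (fN _ ni) => /esym/ni.
  - by rewrite !fN.
have [[k ->]|nj] := rangeP j; last by exists j => //; apply: fN.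
by exists (s (k - 1)%R) => //; rewrite fs subrK.
Qed.

Lemma reversible_union_Z_sequence (T I : Type) (X : I -> structure T) :
  (forall i j, i <> j -> sdom (X i) `&` sdom (X j) = set0) ->
  reversible (union X setT) ->
  forall s, Z_sequence X s -> trivial_Z_sequence X s.
Proof.
move=> disjX revU s [injs les] k l.
have [f symf [fs fN]] := shift_bijection injs.
(* The shift [f] moves along the range of [s] and fixes all other indices, where the identity
   condenses. *)
have leX i : cond_le (X i) (X (f i)).
  have [[h <-]|ns] := pselect (exists h, s h = i).
    by rewrite fs; apply: les; rewrite ltrDl.
  rewrite fN => [|h sh]; first exact: cond_le_refl.
  by apply: ns; exists h.
have isoS h : isomorphic (X (s h)) (X (s (h + 1)%R)).
  by rewrite -fs; apply: (@reversible_union_glue_iso _ _ X f).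
apply: (@int_shift_ind (fun h => isomorphic (X (s k)) (X (s h))) _ k).
  move=> h; split=> isokh; apply: isomorphic_trans isokh _; first exact: isoS.
  exact/isomorphic_sym/isoS.
exact: isomorphic_refl.
Qed.

Theorem theorem1p2 (T I : Type) (X : I -> structure T)
  (disjX : forall i j : I, i <> j -> sdom (X i) `&` sdom (X j) = set0)
  (connX : forall i : I, connected (X i))
  (revX : forall i : I, reversible (X i)) :
  reversible (union X setT) <->
  (reversible_sequence X /\
   forall s : int -> I, Z_sequence X s -> trivial_Z_sequence X s).
Proof.
split=> [revU|[revseq trivX]]; last exact: union_reversible.
split; first exact: reversible_union_sequence.
exact: reversible_union_Z_sequence.
Qed.
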